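(* Every $3$-Lie superalgebra over $\mathbb{C}$ whose super vector space dimension is $2|1$ is either Abelian or isomorphic to a $3$-Lie superalgebra $\mathfrak{h}$ whose non-trivial commutation relations are one of the following: $$\text{(i)}\quad \begin{cases} [e_1,f_1,f_1] = e_1+e_2,\\ [e_2,f_1,f_1] = -e_1-e_2, \end{cases} \qquad \text{(ii)}\quad [e_1,e_2,f_1] = f_1, \qquad\text{or}\qquad \text{(iii)}\quad [f_1,f_1,f_1] = f_1,$$ where $e_1,e_2$ are the even generators of $\mathfrak{h}$ and $f_1$ is the odd generator of $\mathfrak{h}$.
   Context: A super vector space $V = V_{\overline 0} \oplus V_{\overline 1}$ has dimension $m|n$ if $\dim V_{\overline 0}=m$ and $\dim V_{\overline 1}=n$. A homogeneous element $x$ has parity $|x|=\overline 0$ if $x\in V_{\overline 0}$ and $|x|=\overline 1$ if $x\in V_{\overline 1}$. A $3$-Lie superalgebra over $\mathbb{C}$ is a super vector space $\mathfrak{g}$ over $\mathbb{C}$ with a trilinear map $[\cdot,\cdot,\cdot]:\mathfrak{g}^3\to\mathfrak{g}$ such that for all homogeneous elements: (1) $|[x_1,x_2,x_3]| = |x_1|+|x_2|+|x_3|$; (2) $[x_1,x_2,x_3] = -(-1)^{|x_1||x_2|}[x_2,x_1,x_3]$ and $[x_1,x_2,x_3] = -(-1)^{|x_2||x_3|}[x_1,x_3,x_2]$; (3) $[y_1,y_2,[x_1,x_2,x_3]] = [[y_1,y_2,x_1],x_2,x_3] + (-1)^{|x_1|(|y_1|+|y_2|)}[x_1,[y_1,y_2,x_2],x_3]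 + (-1)^{(|x_1|+|x_2|)(|y_1|+|y_2|)}[x_1,x_2,[y_1,y_2,x_3]]$. It is Abelian if its bracket is identically zero. Isomorphisms are parity-preserving linear bijections respecting the brackets. The generators of a $3$-Lie superalgebra of dimension $m|n$ are a basis $e_1,\dots,e_m$ of the even part together with a basis $f_1,\dots,f_n$ of the odd part. Giving the ''non-trivial commutation relations'' means that all brackets of basis elements that do not follow from the listed ones by the graded skew-symmetry (2) are zero. The claim asserts only that every such superalgebra falls under one of the listed alternatives. *)

(* Defs.v *)
From HB Require Import structures.
From mathcomp Require Import all_boot all_order all_algebra.
From mathcomp Require Import reals complex.

Set Implicit Arguments.
Unset Strict Implicit.
Unset Printing Implicit Defensive.

Import GRing.Theory.
Local Open Scope ring_scope.

(* Parities are booleans: false is even, true is odd, addition in Z/2 is the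
   exclusive or (+), and (-1)^{|x||y|} is (-1) ^+ (p && q). *)
Record superVectType (K : fieldType) := SuperVectType {
  super_sort :> vectType K;
  part : bool -> {vspace super_sort};
  part_full : (part false + part true)%VS = fullv;
  part_direct : directv (part false + part true)
}.

Definition super_dim (K : fieldType) (V : superVectType K) : nat * nat :=
  (\dim (part V false), \dim (part V true)).

(* The identities quantify over a parity together with an element of the
   corresponding part, since 0 is homogeneous of both parities. *)
Record lie3SuperAlg (K : fieldType) := Lie3SuperAlg {
  lie3_super :> superVectType K;
  br3 : lie3_super -> lie3_super -> lie3_super -> lie3_super;
  br3_linear1 : forall y z, linear (fun x => br3 x y z);
  br3_linear2 : forall x z, linear (fun y => br3 x y z);
  br3_linear3 : forall x y, linear (fun z => br3 x y z);
  br3_parity : forall (p1 p2 p3 : bool) (x1 x2 x3 : lie3_super),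
    x1 \in part lie3_super p1 -> x2 \in part lie3_super p2 ->
    x3 \in part lie3_super p3 ->
    br3 x1 x2 x3 \in part lie3_super (p1 (+) p2 (+) p3);
  br3_skew12 : forall (p1 p2 p3 : bool) (x1 x2 x3 : lie3_super),
    x1 \in part lie3_super p1 -> x2 \in part lie3_super p2 ->
    x3 \in part lie3_super p3 ->
    br3 x1 x2 x3 = - ((-1) ^+ (p1 && p2) *: br3 x2 x1 x3);
  br3_skew23 : forall (p1 p2 p3 : bool) (x1 x2 x3 : lie3_super),
    x1 \in part lie3_super p1 -> x2 \in part lie3_super p2 ->
    x3 \in part lie3_super p3 ->
    br3 x1 x2 x3 = - ((-1) ^+ (p2 && p3) *: br3 x1 x3 x2);
  br3_fundamental :
    forall (q1 q2 p1 p2 p3 : bool) (y1 y2 x1 x2 x3 : lie3_super),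
    y1 \in part lie3_super q1 -> y2 \in part lie3_super q2 ->
    x1 \in part lie3_super p1 -> x2 \in part lie3_super p2 ->
    x3 \in part lie3_super p3 ->
    br3 y1 y2 (br3 x1 x2 x3) =
      br3 (br3 y1 y2 x1) x2 x3
      + (-1) ^+ (p1 && (q1 (+) q2)) *: br3 x1 (br3 y1 y2 x2) x3
      + (-1) ^+ ((p1 (+) p2) && (q1 (+) q2)) *: br3 x1 x2 (br3 y1 y2 x3)
}.

Definition abelian3 (K : fieldType) (g : lie3SuperAlg K) : Prop :=
  forall x y z : g, br3 x y z = 0.

Definition isomorphic3 (K : fieldType) (g h : lie3SuperAlg K) : Prop :=
  exists phi : 'Hom(g, h),
    [/\ bijective phi,
        forall (p : bool) (x : g), x \in part g p -> phi x \in part h p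
      & forall x y z : g, phi (br3 x y z) = br3 (phi x) (phi y) (phi z)].

Definition generators (K : fieldType) (V : superVectType K) (e f : seq V) :
    Prop :=
  basis_of (part V false) e /\ basis_of (part V true) f.

(* An entry ([:: x; y; z], v) of the table t stands for [x, y, z] = v. Graded
   skew-symmetry relates the brackets of two triples of generators exactly when
   the triples are permutations of one another, so every triple of generators
   that is not a permutation of a listed one has zero bracket. *)
Definition nontrivial_relations (K : fieldType) (g : lie3SuperAlg K)
    (b : seq g) (t : seq (seq g * g)) : Prop :=
  (forall x y z v : g, ([:: x; y; z], v) \in t -> br3 x y z = v) /\
  (forall x y z : g, x \in b -> y \in b -> z \in b ->
     ~~ has (fun r => perm_eq [:: x; y; z] r.1) t -> br3 x y z = 0).

(* Main.v *)
Require Import Defs.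
From HB Require Import structures.
From mathcomp Require Import all_boot all_order all_algebra.
From mathcomp Require Import reals complex.
From mathcomp Require Import zify.

Set Implicit Arguments.
Unset Strict Implicit.
Unset Printing Implicit Defensive.

Import GRing.Theory.
Local Open Scope ring_scope.

(** Let e1, e2 be even generators and f an odd generator.  The bracket is
    alternating in even arguments and symmetric in odd ones, so in dimension
    2|1 it is determined by [e1,e2,f] = a f, by the endomorphism
    T e = [e,f,f] of the even part, and by [f,f,f] = c f.  The fundamental
    identity, read as saying that every [y1,y2,-] is a superderivation, leaves
    little room.
    - [f,f,-] applied to [f,f,f] gives c^2 = 3 c^2, so c = 0
      ([odd_cube_eq0]).
    - [e,f,-] applied to [f,f,f] = 0 gives 3 T^2 = 0, so T^2 = 0
      ([odd_square_nilpotent]).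
    - [e1,e2,-] applied to [e,f,f] gives 2 a T = 0, because [e1,e2,-] kills
      the even part ([odd_square_eq0]).
    If T <> 0, choose v with w = T v <> 0; then T w = 0, the vectors v and
    w - v form an even basis with T v = w and T (w - v) = - w, and a = 0 in
    this basis: these are relations (i).  If T = 0 and a <> 0, replacing e1 by
    a^-1 e1 gives (ii).  If T = 0 and a = 0, all brackets vanish.

    Since the generators of an algebra may be chosen freely, the isomorphism
    can be taken to be the identity.  The argument is valid over any field in
    which 2 and 3 are invertible. *)

(** * Linear algebra *)

Section LinearAlgebra.
Variables (K : fieldType) (V : vectType K).

Lemma linear_eq0_span (W : vectType K) (f : V -> W) (X : seq V) :
  linear f -> {in X, forall x, f x = 0} -> {in <<X>>%VS, forall x, f x = 0}.
Proof.
move=> lin_f fX0 x xX.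
pose fL : {linear V -> W} := HB.pack f (GRing.isLinear.Build _ _ _ _ f lin_f).
suff: x \in lker (linfun fL) by rewrite memv_ker lfunE => /eqP.
move: x xX; apply/subvP/span_subvP => x xX.
by rewrite memv_ker lfunE; apply/eqP/fX0.
Qed.

Lemma basis_of_dim1 (U : {vspace V}) :
  \dim U = 1%N -> exists u, basis_of U [:: u].
Proof.
move=> dimU; have := vbasisP U; have := size_tuple (vbasis U).
rewrite [X in _ = X]dimU; case: (tval (vbasis U)) => [|u [|? ?]] //= _ basis_u.
by exists u.
Qed.

Lemma basis_of_dim2 (U : {vspace V}) :
  \dim U = 2%N -> exists u v, basis_of U [:: u; v].
Proof.
move=> dimU; have := vbasisP U; have := size_tuple (vbasis U).
rewrite [X in _ = X]dimU; case: (tval (vbasis U)) => [|u [|v [|? ?]]] //= _ basis_uv.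
by exists u, v.
Qed.

Lemma plane_basis (U : {vspace V}) (u v : V) :
  \dim U = 2%N -> u \in U -> v \in U -> v != 0 -> u \notin <[v]>%VS ->
  basis_of U [:: u; v].
Proof.
move=> dimU uU vU v0 uv; rewrite basisEfree free_cons seq1_free v0 span_seq1 uv.
rewrite dimU /= andbT; apply/span_subvP => x.
by rewrite !inE => /orP[] /eqP ->.
Qed.

Lemma natmul_eq0 (n : nat) (v : V) : n%:R != 0 :> K -> v *+ n = 0 -> v = 0.
Proof.
by move=> n0 /eqP; rewrite -scaler_nat scaler_eq0 (negPf n0) => /eqP.
Qed.

End LinearAlgebra.

(** * Brackets of homogeneous elements *)

Section Bracket.
Variables (K : fieldType) (g : lie3SuperAlg K).
Implicit Types (x y z e f : g) (p : bool).

Notation even := (part g false).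
Notation odd := (part g true).

Lemma br3Zl k x y z : br3 (k *: x) y z = k *: br3 x y z.
Proof.
have br0: br3 0 y z = 0.
  have := br3_linear1 y z (-1) 0 0.
  by rewrite scaler0 addr0 scaleN1r addNr.
by have := br3_linear1 y z k x 0; rewrite /= !addr0 br0 addr0.
Qed.

Lemma br3Zm k x y z : br3 x (k *: y) z = k *: br3 x y z.
Proof.
have br0: br3 x 0 z = 0.
  have := br3_linear2 x z (-1) 0 0.
  by rewrite scaler0 addr0 scaleN1r addNr.
by have := br3_linear2 x z k y 0; rewrite /= !addr0 br0 addr0.
Qed.

Lemma br3Zr k x y z : br3 x y (k *: z) = k *: br3 x y z.
Proof.
have br0: br3 x y 0 = 0.
  have := br3_linear3 x y (-1) 0 0.
  by rewrite scaler0 addr0 scaleN1r addNr.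
by have := br3_linear3 x y k z 0; rewrite /= !addr0 br0 addr0.
Qed.

Lemma br3_r0 x y : br3 x y 0 = 0 :> g.
Proof. by have := br3Zr 0 x y 0; rewrite !scale0r. Qed.

Lemma br3Bl x x' y z : br3 (x - x') y z = br3 x y z - br3 x' y z.
Proof.
have := br3_linear1 y z (-1) x' x.
by rewrite /= !scaleN1r ![- _ + _]addrC.
Qed.

Definition homogeneous x := exists p, x \in part g p.

Lemma even_homogeneous x : x \in even -> homogeneous x.
Proof. by exists false. Qed.

Lemma odd_homogeneous x : x \in odd -> homogeneous x.
Proof. by exists true. Qed.

Lemma br3_swap12_eq0 x y z :
    homogeneous x -> homogeneous y -> homogeneous z ->
  br3 x y z = 0 -> br3 y x z = 0.
Proof.
move=> [p xp] [q yq] [r zr] xyz0.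
by rewrite (br3_skew12 yq xp zr) xyz0 scaler0 oppr0.
Qed.

Lemma br3_swap23_eq0 x y z :
    homogeneous x -> homogeneous y -> homogeneous z ->
  br3 x y z = 0 -> br3 x z y = 0.
Proof.
move=> [p xp] [q yq] [r zr] xyz0.
by rewrite (br3_skew23 xp zr yq) xyz0 scaler0 oppr0.
Qed.

(** Graded skew-symmetry changes a bracket of homogeneous elements by a sign
    only, so its vanishing does not depend on the order of the arguments; this
    is what lets the parity signs be ignored when comparing with a table. *)
Lemma br3_perm_eq0 x y z x' y' z' :
    homogeneous x -> homogeneous y -> homogeneous z ->
    perm_eq [:: x; y; z] [:: x'; y'; z'] ->
  br3 x y z = 0 -> br3 x' y' z' = 0.
Proof.
move=> hx hy hz xyz xyz0.
(* A property of sequences stable under exchanging adjacent blocks is stable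
   under permutation; blocks of a triple are few enough to enumerate. *)
pose vanishing (s : seq g) := exists a b c, [/\ s = [:: a; b; c],
  homogeneous a, homogeneous b, homogeneous c & br3 a b c = 0].
suff: vanishing [:: x'; y'; z'] by case=> [a [b [c [[-> -> ->]]]]].
apply: (catCA_perm_ind (P := vanishing) _ xyz); last by exists x, y, z.
move=> s1 s2 s3 [a [b [c [s123 ha hb hc abc0]]]].
have acb0 := br3_swap23_eq0 ha hb hc abc0.
have bac0 := br3_swap12_eq0 ha hb hc abc0.
have cab0 := br3_swap12_eq0 ha hc hb acb0.
have bca0 := br3_swap23_eq0 hb ha hc bac0.
case: s1 s2 s3 s123 => [|a1 [|b1 [|c1 [|d1 s1]]]] [|a2 [|b2 [|c2 [|d2 s2]]]] //=;
  (case=> [|a3 [|b3 [|c3 [|d3 s3]]]] //=); case=> *; subst;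
  by do 3 eexists; split.
Qed.

Section Identities.
Hypothesis two_neq0 : 2%:R != 0 :> K.

Lemma br3_even_alternating e x :
  e \in even -> homogeneous x -> br3 e e x = 0.
Proof.
move=> ev [p xp]; apply: (natmul_eq0 two_neq0).
by rewrite mulr2n {1}(br3_skew12 ev ev xp) expr0 scale1r addNr.
Qed.

(** [f,f,-] multiplies f by c, so as a derivation it multiplies [f,f,f] by
    3 c; but it also multiplies [f,f,f] = c f by c. *)
Lemma odd_cube_eq0 f : basis_of odd [:: f] -> br3 f f f = 0.
Proof.
move=> basis_f.
have fo : f \in odd by rewrite (basis_mem basis_f) ?inE.
have : br3 f f f \in odd by exact: (br3_parity fo fo fo).
rewrite -(span_basis basis_f) span_seq1 => /vlineP[c fff].
have := br3_fundamental fo fo fo fo fo.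
rewrite /= expr0 !scale1r !fff br3Zr br3Zl br3Zm fff => /esym.
rewrite -[RHS]add0r => /addIr; rewrite -mulr2n => /(natmul_eq0 two_neq0).
by move/eqP; rewrite scalerA scaler_eq0 mulf_eq0 orbb -scaler_eq0 => /eqP ->.
Qed.

(** [e,f,-] is an odd derivation sending f to [e,f,f], and the three terms of
    its value on [f,f,f] agree because moving an even argument past f changes
    the sign. *)
Lemma odd_square_nilpotent e f : 3%:R != 0 :> K ->
  e \in even -> f \in odd -> br3 f f f = 0 -> br3 (br3 e f f) f f = 0.
Proof.
move=> three_neq0 ev fo fff.
have ev' : br3 e f f \in even by exact: (br3_parity ev fo fo).
have := br3_fundamental ev fo fo fo fo.
rewrite /= fff br3_r0 expr0 expr1 scale1r scaleN1r.
have -> : br3 f f (br3 e f f) = - br3 f (br3 e f f) f.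
  by rewrite (br3_skew23 fo fo ev') expr0 scale1r.
rewrite (br3_skew12 fo ev' fo) expr0 scale1r opprK => /esym.
by rewrite -mulr2n -mulrSr; apply: natmul_eq0.
Qed.

Section Generators.
Variables e1 e2 f : g.
Hypothesis basis_e : basis_of even [:: e1; e2].
Hypothesis basis_f : basis_of odd [:: f].

Lemma generator_even1 : e1 \in even.
Proof. by rewrite (basis_mem basis_e) ?inE ?eqxx. Qed.

Lemma generator_even2 : e2 \in even.
Proof. by rewrite (basis_mem basis_e) ?inE ?eqxx ?orbT. Qed.

Lemma generator_odd : f \in odd.
Proof. by rewrite (basis_mem basis_f) ?inE ?eqxx. Qed.

Let ev1 := generator_even1.
Let ev2 := generator_even2.
Let fo := generator_odd.

Lemma generator_homogeneous x : x \in [:: e1; e2; f] -> homogeneous x.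
Proof.
by rewrite !inE => /or3P[] /eqP ->;
  [exact: even_homogeneous | exact: even_homogeneous | exact: odd_homogeneous].
Qed.

Lemma br3_even_plane e : e \in even -> br3 e1 e2 e = 0.
Proof.
rewrite -(span_basis basis_e).
apply: linear_eq0_span (br3_linear3 e1 e2) _ e => e.
have h1 := even_homogeneous ev1; have h2 := even_homogeneous ev2.
rewrite !inE => /orP[] /eqP ->.
- by apply: br3_swap23_eq0 => //; apply: br3_even_alternating.
- apply: (@br3_perm_eq0 e2 e2 e1) => //; first by apply/permP => P /=; lia.
  exact: br3_even_alternating.
Qed.

Lemma br3_even_even_odd : exists a, br3 e1 e2 f = a *: f.
Proof.
have : br3 e1 e2 f \in odd by exact: (br3_parity ev1 ev2 fo).
by rewrite -(span_basis basis_f) span_seq1 => /vlineP.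
Qed.

(** [e1,e2,-] kills even elements and multiplies f by a, hence multiplies
    [e,f,f] by 2 a; but [e,f,f] is even, so it is killed. *)
Lemma odd_square_eq0 a e :
  br3 e1 e2 f = a *: f -> e \in even -> a = 0 \/ br3 e f f = 0.
Proof.
move=> e12f ev.
have ev' : br3 e f f \in even by exact: (br3_parity ev fo fo).
have br0ff : br3 0 f f = 0 :> g by have := br3Zl 0 0 f f; rewrite !scale0r.
have := br3_fundamental ev1 ev2 ev fo fo.
rewrite /= expr0 !scale1r e12f !br3_even_plane // br0ff add0r br3Zm br3Zr.
rewrite -mulr2n => /esym/(natmul_eq0 two_neq0)/eqP.
by rewrite scaler_eq0 => /orP[] /eqP ->; [left | right].
Qed.

(** Any other triple is three copies of f or repeats an even generator. *)
Lemma br3_generators_eq0 x y z :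
    x \in [:: e1; e2; f] -> y \in [:: e1; e2; f] -> z \in [:: e1; e2; f] ->
    ~~ perm_eq [:: x; y; z] [:: e1; e2; f] ->
    ~~ perm_eq [:: x; y; z] [:: e1; f; f] ->
    ~~ perm_eq [:: x; y; z] [:: e2; f; f] ->
  br3 x y z = 0.
Proof.
have alt12 e u : e \in even -> u \in [:: e1; e2; f] -> br3 e e u = 0.
  by move=> ev /generator_homogeneous; apply: br3_even_alternating.
have alt13 e u : e \in even -> u \in [:: e1; e2; f] -> br3 e u e = 0.
  move=> ev ub; apply: br3_swap23_eq0; last exact: alt12.
  - exact: even_homogeneous.
  - exact: even_homogeneous.
  - exact: generator_homogeneous.
have alt23 e u : e \in even -> u \in [:: e1; e2; f] -> br3 u e e = 0.
  move=> ev ub; apply: br3_swap12_eq0; last exact: alt13.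
  - exact: even_homogeneous.
  - exact: generator_homogeneous.
  - exact: even_homogeneous.
move=> xb yb zb.
move: (xb) (yb) (zb); rewrite [x \in _]inE [y \in _]inE [z \in _]inE !inE.
move=> /or3P[] /eqP ? /or3P[] /eqP ? /or3P[] /eqP ?; subst x y z;
  move=> n12 n1 n2;
  (* The permutations are verified by counting, so that e1, e2 and f need not
     be compared with each other. *)
  first [ exact (alt12 _ _ ev1 zb) | exact (alt12 _ _ ev2 zb)
        | exact (alt13 _ _ ev1 yb) | exact (alt13 _ _ ev2 yb)
        | exact (alt23 _ _ ev1 xb) | exact (alt23 _ _ ev2 xb)
        | exact (odd_cube_eq0 basis_f)
        | by case/negP: n12; apply/permP => P /=; clear; lia
        | by case/negP: n1; apply/permP => P /=; clear; lia
        | by case/negP: n2; apply/permP => P /=; clear; lia ].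
Qed.

Lemma br3_generator_perm_eq0 x y z u v w :
    u \in [:: e1; e2; f] -> v \in [:: e1; e2; f] -> w \in [:: e1; e2; f] ->
    br3 u v w = 0 -> perm_eq [:: x; y; z] [:: u; v; w] ->
  br3 x y z = 0.
Proof.
move=> /generator_homogeneous hu /generator_homogeneous hv.
move=> /generator_homogeneous hw uvw0; rewrite perm_sym => uvw_xyz.
exact: br3_perm_eq0 hu hv hw uvw_xyz uvw0.
Qed.

Let e1b : e1 \in [:: e1; e2; f]. Proof. by rewrite !inE eqxx. Qed.
Let e2b : e2 \in [:: e1; e2; f]. Proof. by rewrite !inE eqxx orbT. Qed.
Let fb : f \in [:: e1; e2; f]. Proof. by rewrite !inE eqxx !orbT. Qed.

Lemma nilpotent_relations :
    br3 e1 f f = e1 + e2 -> br3 e2 f f = - e1 - e2 -> br3 e1 e2 f = 0 ->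
  nontrivial_relations [:: e1; e2; f]
    [:: ([:: e1; f; f], e1 + e2); ([:: e2; f; f], - e1 - e2)].
Proof.
move=> e1ff e2ff e12f; split=> [x y z v | x y z xb yb zb].
  by rewrite !inE => /orP[] /eqP[-> -> -> ->].
rewrite /= orbF => /norP[n1 n2].
have [p12|n12] := boolP (perm_eq [:: x; y; z] [:: e1; e2; f]).
  exact: br3_generator_perm_eq0 e12f p12.
exact: br3_generators_eq0.
Qed.

Lemma unit_relations :
    br3 e1 e2 f = f -> br3 e1 f f = 0 -> br3 e2 f f = 0 ->
  nontrivial_relations [:: e1; e2; f] [:: ([:: e1; e2; f], f)].
Proof.
move=> e12f e1ff e2ff; split=> [x y z v | x y z xb yb zb].
  by rewrite !inE => /eqP[-> -> -> ->].
rewrite /= orbF => n12.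
have [p1|n1] := boolP (perm_eq [:: x; y; z] [:: e1; f; f]).
  exact: br3_generator_perm_eq0 e1ff p1.
have [p2|n2] := boolP (perm_eq [:: x; y; z] [:: e2; f; f]).
  exact: br3_generator_perm_eq0 e2ff p2.
exact: br3_generators_eq0.
Qed.

Lemma generators_span : <<[:: e1; e2; f]>>%VS = fullv :> {vspace g}.
Proof.
rewrite -(part_full g) -(span_basis basis_e) -(span_basis basis_f).
by rewrite -span_cat.
Qed.

Lemma generators_abelian :
    br3 e1 e2 f = 0 -> br3 e1 f f = 0 -> br3 e2 f f = 0 -> abelian3 g.
Proof.
move=> e12f e1ff e2ff.
have gen0 x y z : x \in [:: e1; e2; f] -> y \in [:: e1; e2; f] ->
    z \in [:: e1; e2; f] -> br3 x y z = 0.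
  move=> xb yb zb.
  have [p12|n12] := boolP (perm_eq [:: x; y; z] [:: e1; e2; f]).
    exact: br3_generator_perm_eq0 e12f p12.
  have [p1|n1] := boolP (perm_eq [:: x; y; z] [:: e1; f; f]).
    exact: br3_generator_perm_eq0 e1ff p1.
  have [p2|n2] := boolP (perm_eq [:: x; y; z] [:: e2; f; f]).
    exact: br3_generator_perm_eq0 e2ff p2.
  exact: br3_generators_eq0.
have full x : x \in <<[:: e1; e2; f]>>%VS by rewrite generators_span memvf.
move=> x y z.
apply: (linear_eq0_span (br3_linear1 y z) _ (full x)) => x' xb.
apply: (linear_eq0_span (br3_linear2 x' z) _ (full y)) => y' yb.
apply: (linear_eq0_span (br3_linear3 x' y') _ (full z)) => z' zb.
exact: gen0.
Qed.

End Generators.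

(** The vector [v,f,f] is not proportional to v, because e |-> [e,f,f] squares
    to zero; so v and [v,f,f] - v form a basis. *)
Lemma nilpotent_basis v f : \dim even = 2%N -> v \in even -> f \in odd ->
    br3 v f f != 0 -> br3 (br3 v f f) f f = 0 ->
  basis_of even [:: v; br3 v f f - v].
Proof.
move=> dim_even ev fo; set w := br3 v f f => w0 wff.
have ew : w \in even by exact: (br3_parity ev fo fo).
have wv k : w != k *: v.
  apply/eqP => wkv; have /eqP : k *: w = 0 by rewrite -br3Zl -wkv.
  rewrite scaler_eq0 (negPf w0) orbF => /eqP k0.
  by move: w0; rewrite wkv k0 scale0r eqxx.
have wv0 : w - v != 0 by rewrite subr_eq0; have := wv 1; rewrite scale1r.
apply: plane_basis => //; first exact: rpredB.
apply/vlineP => -[k vk].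
have [k0|k0] := eqVneq k 0.
  have w_eq0 : w = 0 by rewrite /w vk k0 br3Zl scale0r.
  by rewrite w_eq0 eqxx in w0.
have /eqP[] := wv (k^-1 + 1).
by rewrite scalerDl scale1r {1}vk scalerA mulVf // scale1r subrK.
Qed.

End Identities.

End Bracket.

(** * Classification *)

Theorem classification_2_1 (K : fieldType) (g : lie3SuperAlg K) :
    2%:R != 0 :> K -> 3%:R != 0 :> K -> super_dim g = (2%N, 1%N) ->
  abelian3 g \/ exists e1 e2 f : g, generators [:: e1; e2] [:: f] /\
    (nontrivial_relations [:: e1; e2; f]
       [:: ([:: e1; f; f], e1 + e2); ([:: e2; f; f], - e1 - e2)] \/
     nontrivial_relations [:: e1; e2; f] [:: ([:: e1; e2; f], f)]).
Proof.
move=> two_neq0 three_neq0 [dim_even dim_odd].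
have [f basis_f] := basis_of_dim1 dim_odd.
have [e1 [e2 basis_e]] := basis_of_dim2 dim_even.
have fo := generator_odd basis_f.
have ev1 := generator_even1 basis_e.
have ev2 := generator_even2 basis_e.
have fff := odd_cube_eq0 two_neq0 basis_f.
have nilpotent v : v \in part g false -> br3 v f f != 0 ->
    exists e1 e2 f : g, generators [:: e1; e2] [:: f] /\
      nontrivial_relations [:: e1; e2; f]
        [:: ([:: e1; f; f], e1 + e2); ([:: e2; f; f], - e1 - e2)].
  move=> ev w0.
  have wff := odd_square_nilpotent three_neq0 ev fo fff.
  have basis_v := nilpotent_basis dim_even ev fo w0 wff.
  exists v, (br3 v f f - v), f; split; first by split.
  apply: nilpotent_relations => //.
  - by rewrite addrC subrK.
  - by rewrite br3Bl wff sub0r opprB addrA addNr add0r.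
  have [a vwf] := br3_even_even_odd basis_v basis_f.
  have [a0|/eqP] := odd_square_eq0 two_neq0 basis_v basis_f vwf ev.
    by rewrite vwf a0 scale0r.
  by rewrite (negPf w0).
have [e1ff|/(nilpotent _ ev1)] := eqVneq (br3 e1 f f) 0; last first.
  by case=> [u1 [u2 [u3 [gen rel]]]]; right; exists u1, u2, u3; split; last left.
have [e2ff|/(nilpotent _ ev2)] := eqVneq (br3 e2 f f) 0; last first.
  by case=> [u1 [u2 [u3 [gen rel]]]]; right; exists u1, u2, u3; split; last left.
have [a e12f] := br3_even_even_odd basis_e basis_f.
have [a0|a0] := eqVneq a 0.
  left; apply: generators_abelian basis_e basis_f _ e1ff e2ff => //.
  by rewrite e12f a0 scale0r.
have basis_ae : basis_of (part g false) [:: a^-1 *: e1; e2].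
  have := basis_free basis_e; rewrite free_cons seq1_free span_seq1.
  case/andP=> e1_e2 e2_0; apply: plane_basis => //; first exact: rpredZ.
  apply: contra e1_e2 => /(rpredZ a).
  by rewrite scalerA mulfV // scale1r.
right; exists (a^-1 *: e1), e2, f; split; first by split.
right; apply: unit_relations => //.
- by rewrite br3Zl e12f scalerA mulVf // scale1r.
- by rewrite br3Zl e1ff scaler0.
Qed.

Lemma isomorphic3_refl (K : fieldType) (g : lie3SuperAlg K) : isomorphic3 g g.
Proof.
exists \1%VF; split=> [|p x xp|x y z]; rewrite ?id_lfunE //.
by exists \1%VF => x; rewrite !id_lfunE.
Qed.

Unset Implicit Arguments.
Set Strict Implicit.

Theorem theorem5 (R : realType) (g : lie3SuperAlg R[i])
    (hdim : super_dim g = (2%N, 1%N)) :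
  abelian3 g \/
  exists h : lie3SuperAlg R[i],
    isomorphic3 g h /\
    exists e1 e2 f1 : h,
      generators [:: e1; e2] [:: f1] /\
      [\/ nontrivial_relations [:: e1; e2; f1]
            [:: ([:: e1; f1; f1], e1 + e2); ([:: e2; f1; f1], - e1 - e2)],
          nontrivial_relations [:: e1; e2; f1] [:: ([:: e1; e2; f1], f1)]
        | nontrivial_relations [:: e1; e2; f1] [:: ([:: f1; f1; f1], f1)]].
Proof.
have nat_neq0 n : n.+1%:R != 0 :> R[i] by rewrite Num.Theory.pnatr_eq0.
have [|[e1 [e2 [f [gen rel]]]]] :=
  classification_2_1 (nat_neq0 1%N) (nat_neq0 2%N) hdim; first by left.
right; exists g; split; first exact: isomorphic3_refl.
exists e1, e2, f; split=> //.
by case: rel => rel; [constructor 1 | constructor 2].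
Qed.
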